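(* Consider a round of Algorithm SE-A with $z=2$ and current simple graph $\mathcal{G}(V,E)$ in which every vertex has degree at least $2$. For any two distinct vertices $u,w\in V$, the joint inclusion probability $\pi_{uw}$, i.e. the probability that the pair selected in this round is $\{u,w\}$, is bounded below by $$\pi_{uw}\ \ge\ \frac{2}{3|E|^2}.$$
   Context: **Random systematic sampling (RSS).** Input: distinct elements $x_1,\dots,x_N$ with positive integer frequencies $d_1,\dots,d_N$, $s=\sum_i d_i$, and a sample size $m$ dividing $s$ (here always $d_i\le s/m$). Permute the elements (together with their frequencies) uniformly at random; independently draw $r$ uniformly from $[0,s/m)$; with $D_i=d_1+\dots+d_i$ (in the permuted order, $D_0=0$), output for each $j=0,1,\dots,m-1$ the element $x_i$ for which $D_{i-1}\le r+j\,s/m<D_i$. **Round of Algorithm SE-A with $z=2$.** Select two edges $e_1,e_2$ of $E$ independently and uniformly at random (with replacement). Form the bag of endpoints of $e_1,e_2$, each vertex having frequency equal to the number of indices $i\in\{1,2\}$ with the vertex in $e_i$ (total frequency $4$), and apply RSS with sample size $m=2$. The output is the selected pair (a new vertex is then joined to both of its elements). *)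

(* Defs.v *)
From HB Require Import structures.
From mathcomp Require Import all_boot all_order all_fingroup all_algebra.
From mathcomp Require Import all_classical all_reals all_analysis.

Set Implicit Arguments.
Unset Strict Implicit.
Unset Printing Implicit Defensive.

Import Order.TTheory GRing.Theory Num.Theory.
Local Open Scope ring_scope.

(* Simple graphs are given by a symmetric irreflexive adjacency relation [adj];
   edges are the two-element sets of endpoints of adjacent vertices. *)

Definition edges (V : finType) (adj : rel V) : {set {set V}} :=
  [set [set p.1; p.2]%SET | p : V * V & adj p.1 p.2]%SET.

Definition degree (V : finType) (adj : rel V) (v : V) : nat :=
  #|[set w | adj v w]%SET|.

(* Random systematic sampling.  The elements are x 0, ..., x (N-1), with
   frequencies d 0, ..., d (N-1); in the order permuted by p, the i-th element
   is x (p i) and has frequency d (p i). *)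

Definition rss_total (N : nat) (d : 'I_N -> nat) : nat := (\sum_(i < N) d i)%N.

Definition rss_step (R : realType) (N m : nat) (d : 'I_N -> nat) : R :=
  (rss_total d)%:R / m%:R.

(* D_i, the total frequency of the first i elements of the permuted order.
   Indices start at 0, so the i-th element owns the interval [D_i, D_(i+1)[. *)
Definition rss_cum (N : nat) (d : 'I_N -> nat) (p : 'S_N) (i : nat) : nat :=
  (\sum_(k < N | k < i) d (p k))%N.

(* With offset r, the j-th point r + j s/m falls on the i-th element. *)
Definition rss_hit (R : realType) (N m : nat) (d : 'I_N -> nat) (p : 'S_N)
    (r : R) (j : 'I_m) (i : 'I_N) : bool :=
  let y := r + j%:R * rss_step R m d in
  ((rss_cum d p i)%:R <= y) && (y < (rss_cum d p i.+1)%:R).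

(* The set of all outputs, for j = 0, ..., m-1, given the permutation p and the
   offset r. *)
Definition rss_sample (R : realType) (T : finType) (N m : nat) (x : 'I_N -> T)
    (d : 'I_N -> nat) (p : 'S_N) (r : R) : {set T} :=
  [set x (p i) | i : 'I_N & [exists j : 'I_m, rss_hit d p r j i]]%SET.

(* The offsets in [0, s/m[ that yield the sample A. *)
Definition rss_offsets (R : realType) (T : finType) (N m : nat) (x : 'I_N -> T)
    (d : 'I_N -> nat) (p : 'S_N) (A : {set T}) : set R :=
  [set r : R | 0 <= r /\ r < rss_step R m d /\ rss_sample m x d p r = A]%classic.

(* The probability that the sample is A, for p uniform in 'S_N and, independently,
   r uniform in [0, s/m[.  The integral unfolds [uniform_prob], which would need
   a proof that 0 < s/m and is supported by the closed interval [0, s/m]. *)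
Definition rss_prob (R : realType) (T : finType) (N m : nat) (x : 'I_N -> T)
    (d : 'I_N -> nat) (A : {set T}) : \bar R :=
  ((N`!%:R^-1)%:E *
   \sum_(p : 'S_N)
     \int[lebesgue_measure]_(r in rss_offsets m x d p A)
       (uniform_pdf 0 (rss_step R m d) r)%:E)%E.

(* A bag over T is given by its multiplicity function b.  Its elements are
   enumerated in a fixed order, which is irrelevant since RSS shuffles them. *)

Definition bag_support (T : finType) (b : T -> nat) : {set T} :=
  [set v | (0 < b v)%N]%SET.

Definition bag_rss_prob (R : realType) (T : finType) (m : nat) (b : T -> nat)
    (A : {set T}) : \bar R :=
  let x := fun i : 'I_#|bag_support b| => enum_val i in
  rss_prob R m x (fun i => b (x i)) A.

Definition endpoint_bag (V : finType) (e1 e2 : {set V}) (v : V) : nat :=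
  ((v \in e1) + (v \in e2))%N.

(* The probability that the pair selected in a round of SE-A with z = 2 is A. *)
Definition sea2_prob (R : realType) (V : finType) (adj : rel V) (A : {set V})
    : \bar R :=
  (((#|edges adj| ^ 2)%N%:R^-1)%:E *
   \sum_(e1 in edges adj) \sum_(e2 in edges adj)
     bag_rss_prob R 2 (endpoint_bag e1 e2) A)%E.

(* Main.v *)
(* Let u and w be distinct.  If u and w are adjacent, drawing the edge uw twice
   gives the bag {u, u, w, w}, from which RSS selects {u, w} with certainty.
   Otherwise, take distinct neighbours a1, a2 of u and b1, b2 of w, numbered so
   that a1 <> b1 and a2 <> b2: each of the four ordered draws (u a1, w b1),
   (u a2, w b2), (w b1, u a1), (w b2, u a2) consists of disjoint edges, and RSS
   then selects {u, w} with probability 1/6, one of the six pairs.  So at least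
   min(1, 4/6) = 2/3 of the |E|^2 equally likely draws is collected. *)
Require Import Defs.
From mathcomp Require Import all_boot all_order all_fingroup all_algebra.
From mathcomp Require Import all_classical all_reals all_analysis.
From mathcomp Require Import ring lra zify.
Import Order.TTheory GRing.Theory Num.Theory.
Local Open Scope ring_scope.

(** These permutations form a coset: all of them are [s * q], where [q] is one fixed solution and
    [s] (applied first) fixes [a] and [b]. *)
Lemma card_perm_map2 (T : finType) (a b i j : T) : a != b -> i != j ->
  #|[set p : {perm T} | (p a == i) && (p b == j)]%SET| = (#|T| - 2)`!.
Proof.
move=> ab ij; pose q := (tperm a i * tperm (tperm a i b) j)%g.
have qa : q a = i.
  rewrite permM tpermL tpermD //; last by rewrite eq_sym.
  by rewrite -[X in _ != X](tpermL a i) (inj_eq perm_inj) eq_sym.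
have qb : q b = j by rewrite permM tpermL.
have -> : [set p : {perm T} | (p a == i) && (p b == j)]%SET =
    [set (s * q)%g | s in perm_on (~: [set a; b]%SET)]%SET.
  apply/setP => p; rewrite inE; apply/andP/imsetP => [[/eqP pa /eqP pb]|].
    exists (p * q^-1)%g; last by rewrite mulgKV.
    apply/fintype.subsetP => x; rewrite !inE; apply: contra.
    by case/orP => /eqP ->; rewrite permM ?pa ?pb -?qa -?qb permK.
  case=> s son ->; rewrite (permM s q a) (permM s q b) !(out_perm son) ?inE ?eqxx ?orbT //.
  by rewrite qa qb !eqxx.
rewrite card_imset; last exact: mulIg.
by rewrite card_perm cardsCs finset.setCK cards2 ab.
Qed.

(** * Systematic sampling with constant frequencies *)

Section RSSBasics.
Context {R : realType} {T : finType}.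

Lemma uniform_pdf_step_ge0 (N m : nat) (d : 'I_N -> nat) (r : R) :
  0 <= uniform_pdf 0 (rss_step R m d) r.
Proof.
rewrite /uniform_pdf; case: ifP => // _.
by rewrite invr_ge0 subr0 /rss_step divr_ge0.
Qed.

Lemma integral_rss_offsets_ge0 (N m : nat) (x : 'I_N -> T) (d : 'I_N -> nat)
    (p : 'S_N) (A : {set T}) :
  (0 <= \int[@lebesgue_measure R]_(r in rss_offsets m x d p A)
          (uniform_pdf 0 (rss_step R m d) r)%:E)%E.
Proof. by apply: integral_ge0 => r _; rewrite lee_fin uniform_pdf_step_ge0. Qed.

Lemma rss_prob_ge0 (N m : nat) (x : 'I_N -> T) (d : 'I_N -> nat)
    (A : {set T}) : (0 <= rss_prob R m x d A)%E.
Proof.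
rewrite /rss_prob mule_ge0 ?lee_fin ?invr_ge0 //.
by apply: sume_ge0 => p _; exact: integral_rss_offsets_ge0.
Qed.

Lemma integral_uniform_pdf_itv (c a b : R) : 0 <= a -> a <= b -> b <= c ->
  (\int[lebesgue_measure]_(r in `[a, b[%classic) (uniform_pdf 0 c r)%:E =
   ((b - a) / c)%:E)%E.
Proof.
move=> a0 ab bc.
rewrite (@eq_integral _ _ _ _ _ (cst (c^-1)%:E)).
  rewrite integral_cst //= lebesgue_measure_itv /= lte_fin.
  move: ab; rewrite le_eqVlt => /orP[/eqP <-|ab].
    by rewrite ltxx mule0 subrr mul0r.
  by rewrite ab -EFinD -EFinM mulrC.
move=> r; rewrite inE /= in_itv /= => /andP[ar rb].
by rewrite /uniform_pdf subr0 (le_trans a0 ar) (le_trans (ltW rb) bc).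
Qed.

Lemma rss_cum_const (N c : nat) (p : 'S_N) (i : nat) : (i <= N)%N ->
  rss_cum (fun=> c) p i = (i * c)%N.
Proof.
move=> iN; rewrite /rss_cum sum_nat_const; congr (_ * c)%N.
by rewrite -sum1_card -(big_ord_widen N (fun=> 1%N)) // sum1_card card_ord.
Qed.

Lemma rss_step_const (N m c : nat) :
  rss_step R m (fun _ : 'I_N => c) = (N * c)%:R / m%:R.
Proof. by rewrite /rss_step /rss_total sum_nat_const card_ord. Qed.

End RSSBasics.

(** With as many points as elements the step equals the common frequency [c], so for every order and
    every offset the [j]-th point falls on the [j]-th element. *)
Lemma rss_prob_const (R : realType) (T : finType) (N c : nat) (x : 'I_N -> T) :
  (0 < N)%N -> (0 < c)%N ->
  rss_prob R N x (fun=> c) [set x i | i in 'I_N]%SET = 1%E.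
Proof.
move=> N0 c0; have c0R : 0 < c%:R :> R by rewrite ltr0n.
have stepE : rss_step R N (fun _ : 'I_N => c) = c%:R.
  by rewrite rss_step_const natrM mulrC mulKf // pnatr_eq0 -lt0n.
have offE p : rss_offsets N x (fun=> c) p [set x i | i in 'I_N]%SET =
    `[0, c%:R[%classic :> set R.
  apply/seteqP; split => r; rewrite /rss_offsets /= in_itv /= stepE; first by move=> [-> [->]].
  move=> /andP[r0 rc]; split=> //; split=> //; apply/setP => y.
  apply/imsetP/imsetP => -[i _ ->]; first by exists (p i).
  (* [x i] stands at position [p^-1 i], and the point of that same index hits it. *)
  exists ((p^-1)%g i); rewrite ?permKV // inE; apply/existsP.
  exists ((p^-1)%g i); rewrite /rss_hit stepE !rss_cum_const ?(ltnW (ltn_ord _)) //.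
  by rewrite mulSn natrD natrM; apply/andP; split; lra.
rewrite /rss_prob (eq_bigr (fun=> 1%E)) => [|p _].
  by rewrite sumEFin -EFinM sumr_const card_Sn mulVf //.
by rewrite offE stepE integral_uniform_pdf_itv ?(ltW c0R) // subr0 divff // gt_eqF.
Qed.

(** * Two points among [k + k] elements of frequency 1 *)

Section TwoPoints.
Context {R : realType} {T : finType} (k : nat).
Context (x : 'I_(k + k) -> T) (i j : 'I_(k + k)).
Context (x_inj : injective x) (neq_ij : i != j).

(** The step is [k], so an offset with integer part [t] hits exactly the positions [t] and [k + t].
    Conversely, as [x] and [p] are injective, the sample reveals that position [t] is hit, which
    fixes the integer part of the offset. *)
Lemma rss_offsets_unit (p : 'S_(k + k)) (t : 'I_k) :
  [set x (p (lshift k t)); x (p (rshift k t))]%SET = [set x i; x j]%SET ->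
  rss_offsets 2 x (fun=> 1%N) p [set x i; x j]%SET =
    `[t%:R, t.+1%:R[%classic :> set R.
Proof.
move=> E.
have stepE : rss_step R 2 (fun _ : 'I_(k + k) => 1%N) = k%:R.
  by rewrite rss_step_const muln1 natrD; lra.
have hitE (r : R) (l : 'I_2) (a : 'I_(k + k)) : rss_hit (fun=> 1%N) p r l a =
    (a%:R <= r + l%:R * k%:R < a%:R + 1).
  by rewrite /rss_hit stepE !rss_cum_const ?(ltnW (ltn_ord _)) // !muln1 -natr1.
have tk : t%:R + 1 <= k%:R :> R by rewrite natr1 ler_nat.
have le_nat (y : R) m n : m%:R <= y -> y < n%:R + 1 -> (m <= n)%N.
  by rewrite natr1 -ltnS -(ltr_nat R); exact: le_lt_trans.
apply/seteqP; split => r; rewrite /rss_offsets /= in_itv /= stepE -natr1.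
  move=> [r0 [rk /setP/(_ (x (p (lshift k t))))]].
  rewrite -E !inE eqxx /= => /imsetP[a].
  rewrite inE => /existsP[l]; rewrite hitE => /[swap] /x_inj /perm_inj <- /=.
  (* Position [t < k] can only be hit by the point of index 0: the other one lies at [k] or
     beyond. *)
  case: l => -[|[|//]] /= _; first by rewrite mul0r addr0.
  by move=> /andP[_]; lra.
move=> /andP[tr rt]; split; first by apply: le_trans tr; exact: ler0n.
split; first by lra.
rewrite -E; apply/setP => y; rewrite !inE; apply/imsetP/orP.
  move=> [a]; rewrite inE => /existsP[l]; rewrite hitE => /andP[al la] ->.
  case: l al la => -[|[|//]] /= _ al la; [left|right].
    suff -> : a = lshift k t by [].
    apply/val_inj/anti_leq/andP => /=.
    by split; apply: (le_nat r); lra.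
  suff -> : a = rshift k t by [].
  apply/val_inj/anti_leq/andP => /=.
  by split; apply: (le_nat (r + k%:R)); rewrite ?natrD; lra.
move=> H; case: H => /eqP ->; [exists (lshift k t)|exists (rshift k t)] => //;
  rewrite inE; apply/existsP.
  by exists ord0; rewrite hitE /=; apply/andP; split; lra.
by exists ord_max; rewrite hitE /= natrD; apply/andP; split; lra.
Qed.

Lemma integral_rss_offsets_unit (p : 'S_(k + k)) (t : 'I_k) :
  [set x (p (lshift k t)); x (p (rshift k t))]%SET = [set x i; x j]%SET ->
  (\int[@lebesgue_measure R]_(r in
        rss_offsets 2 x (fun=> 1%N) p [set x i; x j]%SET)
     (uniform_pdf 0 (rss_step R 2 (fun _ : 'I_(k + k) => 1%N)) r)%:E)%E =
  (k%:R^-1)%:E.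
Proof.
move=> E; rewrite (rss_offsets_unit _ _ E) rss_step_const muln1.
have tk : t%:R + 1 <= k%:R :> R by rewrite natr1 ler_nat.
have -> : (k + k)%:R / 2 = k%:R :> R by rewrite natrD; lra.
rewrite integral_uniform_pdf_itv -?[t.+1%:R]natr1 ?ler0n //; last by lra.
by rewrite addrAC subrr add0r mul1r.
Qed.

(** There are [k] positions, 2 directions and [(2k - 2)!] ways to order the rest; each such order
    selects the pair with probability [1/k]. Dividing by [(2k)!] gives [1 / 'C(2k, 2)]. *)
Lemma rss_prob_unit_ge :
  (('C(k + k, 2)%:R^-1)%:E <= rss_prob R 2 x (fun=> 1%N) [set x i; x j]%SET)%E.
Proof.
(* F (t, b) collects the orders in which the points falling on positions t and
   k + t select i and j, in the direction given by b. *)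
pose F (z : 'I_k * bool) : {set 'S_(k + k)} :=
  [set p : 'S_(k + k) |
    (p (lshift k z.1) == if z.2 then i else j) &&
    (p (rshift k z.1) == if z.2 then j else i)]%SET.
have lrs (t t' : 'I_k) : lshift k t != rshift k t'.
  by rewrite -val_eqE /= neq_ltn ltn_addr.
(* As [p] is injective, equal directions force equal positions, and opposite directions would
   identify a position of the first half with one of the second. *)
have FD z z' : z != z' -> [disjoint F z & F z'].
  move=> zz'; apply/pred0P => p /=; apply: contraNF zz'; rewrite !inE.
  case: z z' => [t b] [t' b'] /= /andP[/andP[/eqP pa /eqP pb] /andP[/eqP pa' /eqP pb']].
  move: neq_ij pa pb pa' pb' (lrs t t') (lrs t' t) => ij.
  case: b; case: b' => <- <- E1 E2 n1 n2.
  - by move/perm_inj/lshift_inj : E1 => ->.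
  - by case/negP: n2; rewrite (perm_inj E1).
  - by case/negP: n2; rewrite (perm_inj E1).
  - by move/perm_inj/lshift_inj : E1 => ->.
have cardF z : #|F z| = (k + k - 2)`!.
  by rewrite card_perm_map2 ?card_ord //; case: z.2; rewrite // eq_sym.
have Fint p : p \in (\bigcup_z F z)%SET ->
   (\int[@lebesgue_measure R]_(r in
        rss_offsets 2 x (fun=> 1%N) p [set x i; x j]%SET)
     (uniform_pdf 0 (rss_step R 2 (fun _ : 'I_(k + k) => 1%N)) r)%:E)%E =
  (k%:R^-1)%:E.
  case/bigcupP => -[t b] _; rewrite inE /= => /andP[/eqP pa /eqP pb].
  apply: (integral_rss_offsets_unit p t); rewrite pa pb.
  by case: {pa pb} b => //; rewrite finset.setUC.
(* The inhabitant [i] of ['I_(k + k)] excludes [k = 0]. *)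
have kk : (1 < k + k)%N.
  case: k i => [[[]//]|k' _]; lia.
have cardU : #|(\bigcup_z F z)%SET| = (k * 2 * (k + k - 2)`!)%N.
  rewrite -sum1_card partition_disjoint_bigcup //.
  under eq_bigr do rewrite sum1_card cardF.
  by rewrite sum_nat_const card_prod card_ord card_bool.
rewrite /rss_prob; apply: (@le_trans _ _ (((k + k)`!%:R^-1)%:E *
   \sum_(p in (\bigcup_z F z)%SET) (k%:R^-1)%:E)%E).
  rewrite sumEFin -EFinM lee_fin sumr_const cardU -mulr_natl.
  (* After expanding [(2k)!] as ['C(2k, 2) * (2! * (2k - 2)!)] the two sides are equal; the
     inequality comes only from restricting the sum over orders to the sets [F z]. *)
  rewrite -(bin_fact kk) !natrM.
  have n0 n : (0 < n)%N -> n%:R != 0 :> R by rewrite pnatr_eq0 lt0n.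
  have := n0 k; have := n0 _ (fact_gt0 (k + k - 2)).
  have := n0 'C(k + k, 2); rewrite bin_gt0 kk => /(_ isT).
  move=> h1 h2 /(_ ltac:(lia)) h3.
  rewrite le_eqVlt; apply/orP; left; apply/eqP.
  by field; rewrite h1 h2 h3.
rewrite lee_pmul2l ?lte_fin ?invr_gt0 ?ltr0n ?fact_gt0 //.
rewrite -(eq_bigr _ Fint).
apply: lee_sum_nneg_subset => // p _; exact: integral_rss_offsets_ge0.
Qed.

End TwoPoints.

(** * Sampling from bags *)

Lemma bag_rss_prob_const (R : realType) (T : finType) (m c : nat)
    (b : T -> nat) :
  (0 < m)%N -> (0 < c)%N -> #|bag_support b| = m ->
  {in bag_support b, forall v, b v = c} ->
  bag_rss_prob R m b (bag_support b) = 1%E.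
Proof.
move=> m0 c0 bm bc; rewrite /bag_rss_prob; subst m.
rewrite (_ : (fun i => b (enum_val i)) = fun=> c); last first.
  by apply/funext => i; rewrite bc ?enum_valP.
rewrite -[RHS](@rss_prob_const R T #|bag_support b| c (fun i => enum_val i) m0 c0).
congr (rss_prob _ _ _ _ _); apply/setP => v; apply/idP/imsetP => [vb|[i _ ->]].
  by exists (enum_rank_in vb v); rewrite ?enum_rankK_in.
exact: enum_valP.
Qed.

Lemma bag_rss_prob_unit_ge (R : realType) (T : finType) (k : nat)
    (b : T -> nat) (u w : T) :
  #|bag_support b| = (k + k)%N -> {in bag_support b, forall v, b v = 1%N} ->
  u \in bag_support b -> w \in bag_support b -> u != w ->
  (('C(k + k, 2)%:R^-1)%:E <= bag_rss_prob R 2 b [set u; w]%SET)%E.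
Proof.
move=> bk b1 ub wb uw; rewrite /bag_rss_prob.
rewrite (_ : (fun i => b (enum_val i)) = fun=> 1%N); last first.
  by apply/funext => i; rewrite b1 ?enum_valP.
(* Injectivity of the enumeration and distinctness of the two ranks go into the goal first; once
   enumeration and ranks are generalized, [bk] can rewrite the cardinal inside the index type. *)
have := @enum_val_inj T (mem (bag_support b)).
rewrite -(enum_rankK_in ub ub) -(enum_rankK_in ub wb).
have := contra_neq (enum_rank_in_inj ub wb (Ax0 := ub) (Ay0 := ub)) uw.
move: (enum_rank_in ub u) (enum_rank_in ub w).
move: (@enum_val _ _); rewrite bk => x i j ij x_inj.
exact: rss_prob_unit_ge.
Qed.

(** If an arbitrary pairing has a coincidence, say [a1 = b1], exchanging [b1] and [b2] removes it:
    [b2] differs from [b1 = a1], and [a2] differs from [a1 = b1]. *)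
Lemma exists_offdiagonal_pairs (T : finType) (A B : {set T}) :
  (2 <= #|A|)%N -> (2 <= #|B|)%N ->
  exists a1 a2 b1 b2, [/\ [/\ a1 \in A, a2 \in A, b1 \in B & b2 \in B],
    a1 != a2, b1 != b2, a1 != b1 & a2 != b2].
Proof.
move=> /card_gt1P[a1 [a2 [a1A a2A a12]]] /card_gt1P[b1 [b2 [b1B b2B b12]]].
have [n|] := boolP ((a1 != b1) && (a2 != b2)).
  by case/andP: n; exists a1, a2, b1, b2.
rewrite negb_and !negbK => H; exists a1, a2, b2, b1; split => //.
- by rewrite eq_sym.
- by case/orP: H => /eqP E; [rewrite E|rewrite -E].
- by rewrite eq_sym; case/orP: H => /eqP E; [rewrite -E|rewrite E].
Qed.

(** * Rounds of SE-A and their favourable draws *)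

Section SEA2.
Context {R : realType} {V : finType} (adj : rel V).

Lemma mem_edges (u v : V) : adj u v -> [set u; v]%SET \in edges adj.
Proof. by move=> uv; apply/imsetP; exists (u, v); rewrite ?inE. Qed.

Lemma bag_rss_prob_ge0 (m : nat) (b : V -> nat) (A : {set V}) :
  (0 <= bag_rss_prob R m b A)%E.
Proof. exact: rss_prob_ge0. Qed.

(** This reduces a lower bound to a list of distinct ordered draws, each selecting [A] with
    probability at least [c]; all other draws contribute nonnegative terms. *)
Lemma sea2_prob_ge (A : {set V}) (s : seq ({set V} * {set V})) (c : R) :
  uniq s ->
  {in s, forall e, [/\ e.1 \in edges adj, e.2 \in edges adj &
    (c%:E <= bag_rss_prob R 2 (endpoint_bag e.1 e.2) A)%E]} ->
  (((#|edges adj| ^ 2)%N%:R^-1 * (c *+ size s))%:E <= sea2_prob R adj A)%E.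
Proof.
move=> us H; rewrite /sea2_prob EFinM.
apply: lee_wpmul2l; first by rewrite lee_fin invr_ge0.
rewrite pair_big /=; apply: (@le_trans _ _ (\sum_(e in s) c%:E)%E).
  by rewrite sumEFin lee_fin sumr_const (card_uniqP us).
apply: (@le_trans _ _
    (\sum_(e in s) bag_rss_prob R 2 (endpoint_bag e.1 e.2) A)%E).
  by apply: lee_sum => e /H[].
apply: lee_sum_nneg_subset => [e /H[e1 e2 _]|e _]; last exact: bag_rss_prob_ge0.
by rewrite unfold_in /= e1 e2.
Qed.

Lemma bag_support_endpoint (e1 e2 : {set V}) :
  bag_support (endpoint_bag e1 e2) = (e1 :|: e2)%SET.
Proof. by apply/setP => v; rewrite !inE /endpoint_bag addn_gt0 !lt0b. Qed.

Lemma endpoint_bagC (e1 e2 : {set V}) : endpoint_bag e1 e2 = endpoint_bag e2 e1.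
Proof. by apply/funext => v; rewrite /endpoint_bag addnC. Qed.

Lemma bag_rss_prob_same_edge (u w : V) : u != w ->
  bag_rss_prob R 2 (endpoint_bag [set u; w]%SET [set u; w]%SET) [set u; w]%SET
  = 1%E.
Proof.
move=> uw; have sE := bag_support_endpoint [set u; w]%SET [set u; w]%SET.
rewrite finset.setUid in sE.
(* Both endpoints have frequency 2, and there are as many points as elements. *)
rewrite -[X in bag_rss_prob _ _ _ X]sE (@bag_rss_prob_const _ _ _ 2) //.
  by rewrite sE cards2 uw.
by move=> v; rewrite sE /endpoint_bag => ->.
Qed.

Lemma bag_rss_prob_disjoint_edges (u w a b : V) :
  u != w -> u != a -> w != b -> a != b -> u != b -> w != a ->
  ((6^-1)%:E <= bag_rss_prob R 2 (endpoint_bag [set u; a]%SET [set w; b]%SET)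
                  [set u; w]%SET)%E.
Proof.
move=> uw ua wb ab ub wa.
have dis : ([set u; a] :&: [set w; b] = finset.set0)%SET.
  apply/setP => v; rewrite !inE; apply/andP => -[/orP[]/eqP-> /orP[]/eqP E];
  by move: uw ua wb ab ub wa; rewrite E ?eqxx.
have sE := bag_support_endpoint [set u; a]%SET [set w; b]%SET.
(* Four distinct endpoints of frequency 1, so [k = 2] and ['C(4, 2) = 6]. *)
apply: (@bag_rss_prob_unit_ge _ _ 2) => //.
- by rewrite sE cardsU dis cards0 !cards2 ua wb.
- move=> v; rewrite sE /endpoint_bag; move/setP/(_ v): dis; rewrite !inE.
  by case: (_ || _); case: (_ || _).
- by rewrite sE !inE eqxx.
- by rewrite sE !inE eqxx orbT.
Qed.

End SEA2.

Theorem theorem9 (R : realType) (V : finType) (adj : rel V)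
  (adj_sym : symmetric adj) (adj_irr : irreflexive adj)
  (min_degree : forall v : V, (2 <= degree adj v)%N)
  (u w : V) (neq_uw : u != w) :
  ((2 / (3 * #|edges adj|%:R ^+ 2))%:E <= sea2_prob R adj [set u; w]%SET)%E.
Proof.
have -> : 2 / (3 * #|edges adj|%:R ^+ 2) =
    (#|edges adj| ^ 2)%N%:R^-1 * (2 / 3) :> R.
  by rewrite natrX invfM [LHS]mulrA [LHS]mulrC.
have [adj_uw|nadj_uw] := boolP (adj u w).
  (* The single draw has probability 1 of success, weakened here to 2/3. *)
  have := @sea2_prob_ge R V adj [set u; w]%SET
    [:: ([set u; w]%SET, [set u; w]%SET)] (2 / 3) isT.
  rewrite mulr1n; apply=> e; rewrite inE => /eqP -> /=.
  rewrite mem_edges // bag_rss_prob_same_edge // lee_fin; split=> //; lra.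
have [a1 [a2 [b1 [b2 [[]]]]]] :=
  exists_offdiagonal_pairs _ _ _ (min_degree u) (min_degree w).
rewrite !inE => ua1 ua2 wb1 wb2 a12 b12 ab1 ab2.
have neq x y : adj x y -> x != y by apply: contraTneq => ->; rewrite adj_irr.
have nadj_wu : ~~ adj w u by rewrite adj_sym.
(* Non-adjacency keeps [w] out of the neighbours of [u] and [u] out of those of [w], so the chosen
   edges at [u] and at [w] can only meet in their far endpoints. *)
have nwa a : adj u a -> w != a by move=> ua; apply: contraNneq nadj_uw => ->.
have nub b : adj w b -> u != b by move=> wb; apply: contraNneq nadj_wu => ->.
pose s : seq ({set V} * {set V}) :=
  [:: ([set u; a1], [set w; b1])%SET; ([set u; a2], [set w; b2])%SET;
      ([set w; b1], [set u; a1])%SET; ([set w; b2], [set u; a2])%SET].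
(* The vertex [u] separates the two edges. Hence a draw starting at [u] never equals one starting at
   [w], which leaves only draws in the same order to compare. *)
have e1w a b : adj u a -> adj w b -> ([set u; a] == [set w; b])%SET = false.
  move=> ua wb; apply/eqP => /setP/(_ u).
  by rewrite !inE eqxx (negPf neq_uw) (negPf (nub _ wb)).
have us : uniq s.
  rewrite /= !inE !xpair_eqE !e1w //= ?andbF ?orbF.
  have -> : ([set u; a1] == [set u; a2])%SET = false.
    apply/eqP => /setP/(_ a1).
    by rewrite !inE eqxx orbT (negPf a12) eq_sym (negPf (neq _ _ ua1)).
  have -> : ([set w; b1] == [set w; b2])%SET = false.
    apply/eqP => /setP/(_ b1).
    by rewrite !inE eqxx orbT (negPf b12) eq_sym (negPf (neq _ _ wb1)).
  by [].
have -> : 2 / 3 = 6^-1 *+ size s :> R by rewrite /= -mulr_natl; lra.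
apply: sea2_prob_ge us _ => e.
have H a b : adj u a -> adj w b -> a != b ->
    ((6^-1)%:E <= bag_rss_prob R 2
       (endpoint_bag [set u; a]%SET [set w; b]%SET) [set u; w]%SET)%E.
  by move=> ua wb ab; apply: bag_rss_prob_disjoint_edges; auto.
(* The bag ignores the order of the draw, so the two reversed draws reduce to [H]. *)
rewrite !inE => /or4P[] /eqP -> /=; split; rewrite ?mem_edges //;
  by rewrite 1?(endpoint_bagC [set w; _]%SET) H.
Qed.
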